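(* Suppose $\mathcal{A}*\mathcal{X}=\mathcal{B}$ is consistent. If the TKGK algorithm and the Gram-Schmidt-based TKGK algorithm (applied to the same $\mathcal{A},\mathcal{B}$ with the same truncation parameter $\tau\ge1$) have the identical initial tensor $\mathcal{X}^0$ and identical permutation sequence $\{\pi_k\}_{k\ge0}$, then their generated sequences $\{\mathcal{X}^k\}_{k\ge0}$ coincide exactly.
   Context: Tensor notation. For $\mathcal{A}\in\mathbb{R}^{m\times \ell\times n}$ let $A_1,\dots,A_n$ be its frontal slices. $\operatorname{bcirc}(\mathcal{A})\in\mathbb{R}^{mn\times \ell n}$ is the block circulant matrix whose first block column is $A_1,\dots,A_n$ (top to bottom) and whose $(i,j)$ block is $A_{((i-j) \bmod n)+1}$. $\operatorname{unfold}(\mathcal{A})\in\mathbb{R}^{mn\times \ell}$ stacks $A_1,\dots,A_n$ vertically, and $\operatorname{fold}$ is its inverse. The $t$-product is $\mathcal{A} * \mathcal{Y} = \operatorname{fold}(\operatorname{bcirc}(\mathcal{A})\operatorname{unfold}(\mathcal{Y}))$. $\mathcal{A}^\dagger$ is the tensor with $\operatorname{bcirc}(\mathcal{A}^\dagger)=\operatorname{bcirc}(\mathcal{A})^\dagger$ (Moore-Penrose). $\langle\cdot,\cdot\rangle$ is the entrywise inner product, $\|\cdot\|_F$ the induced norm. $\operatorname{vec}(\mathcal{A})$ stacks the column-wise vectorizations of $A_1,\dots,A_n$. $\mathcal{A}_{i::}\in\mathbb{R}^{1\times \ell\times n}$ is the $i$th horizontal slice. Problem: $\mathcal{A}\in\mathbb{R}^{m\times\ell\times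 n}$, $\mathcal{B}\in\mathbb{R}^{m\times p\times n}$, unknown $\mathcal{X}\in\mathbb{R}^{\ell\times p\times n}$. Projections. $\mathcal{P}_i(\mathcal{X}) = \mathcal{X} - \mathcal{A}_{i::}^\dagger * (\mathcal{A}_{i::}*\mathcal{X} - \mathcal{B}_{i::})$. For a permutation $\pi_k=(\pi_{k,1},\dots,\pi_{k,m})$ of $[m]=\{1,\dots,m\}$, $\mathcal{P}_{\pi_k} = \mathcal{P}_{\pi_{k,m}}\circ\cdots\circ\mathcal{P}_{\pi_{k,1}}$, and $r_{\pi_k}(\mathcal{X})\in\mathbb{R}^{mn\ell\times p}$ is the vertical stacking over $i=1,\dots,m$ of the blocks $$\operatorname{unfold}\big(\mathcal{A}_{\pi_{k,i}::}^\dagger * (\mathcal{A}_{\pi_{k,i}::} * (\mathcal{P}_{\pi_{k,i-1}}\circ\cdots\circ\mathcal{P}_{\pi_{k,1}})(\mathcal{X}) - \mathcal{B}_{\pi_{k,i}::})\big)$$ (for $i=1$ the composition is the identity). Permutation strategies: incremental (IS): $\pi_k=(1,\dots,m)$ for all $k$; shuffle-once (SO): one random permutation $\pi_0$ drawn at the start and $\pi_k=\pi_0$ for all $k$; random reshuffling (RR): a fresh random permutation $\pi_k$ of $[m]$ at each $k$. Both algorithms use $j_{k,\tau}=\max\{k-\tau+1,0\}$. TKGK algorithm. For $k=0,1,\dots$: take $\pi_k$; set $\delta_k=\|\mathcal{P}_{\pi_k}(\mathcal{X}^k)-\mathcal{X}^k\|_F^2$ and stop if $\delta_k=0$; set $\gamma_k=\tfrac12(\|r_{\pi_k}(\mathcal{X}^k)\|_F^2+\delta_k)$;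 with $\vec{x}^i=\operatorname{vec}(\mathcal{X}^i)$, $\vec{d}^k=\operatorname{vec}(\mathcal{P}_{\pi_k}(\mathcal{X}^k)-\mathcal{X}^k)$ and $$M_k=[\vec{x}^{j_{k,\tau}}-\vec{x}^k,\dots,\vec{x}^{k-1}-\vec{x}^k,\vec{d}^k]\in\mathbb{R}^{\ell pn\times(k-j_{k,\tau}+1)},$$ let $s^k$ solve $M_k^\top M_k s^k=\gamma_k e$, where $e$ is the last standard basis vector of $\mathbb{R}^{k-j_{k,\tau}+1}$; set $$\mathcal{X}^{k+1}=\mathcal{X}^k+\sum_{i=1}^{k-j_{k,\tau}}s_i^k(\mathcal{X}^{j_{k,\tau}+i-1}-\mathcal{X}^k)+s^k_{k-j_{k,\tau}+1}(\mathcal{P}_{\pi_k}(\mathcal{X}^k)-\mathcal{X}^k).$$ Gram-Schmidt-based TKGK algorithm. Compute $\mathcal{D}_0=\mathcal{P}_{\pi_0}(\mathcal{X}^0)-\mathcal{X}^0$; stop if $\mathcal{D}_0=0$, otherwise set $\mathcal{U}_0=\mathcal{D}_0$. For $k=0,1,\dots$: set $\gamma_k=\tfrac12(\|r_{\pi_k}(\mathcal{X}^k)\|_F^2+\|\mathcal{D}_k\|_F^2)$, $\lambda_k=\gamma_k/\|\mathcal{U}_k\|_F^2$, $\mathcal{X}^{k+1}=\mathcal{X}^k+\lambda_k\,\mathcal{U}_k$; take $\pi_{k+1}$ and set $\mathcal{D}_{k+1}=\mathcal{P}_{\pi_{k+1}}(\mathcal{X}^{k+1})-\mathcal{X}^{k+1}$;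 stop if $\mathcal{D}_{k+1}=0$, otherwise set $$\mathcal{U}_{k+1}=\mathcal{D}_{k+1}-\sum_{i=j_{k+1,\tau}}^{k}\frac{\langle\mathcal{U}_i,\mathcal{D}_{k+1}\rangle}{\|\mathcal{U}_i\|_F^2}\,\mathcal{U}_i .$$ *)

(* Defs.v *)
From HB Require Import structures.
From mathcomp Require Import all_boot all_order all_algebra.
From mathcomp Require Import perm.
From mathcomp Require Import reals.

Set Implicit Arguments.
Unset Strict Implicit.
Unset Printing Implicit Defensive.

Import Order.TTheory GRing.Theory Num.Theory.
Local Open Scope ring_scope.

(* An m x l x n tensor is the family of its n frontal slices, which are        *)
(* numbered from 0.                                                            *)
Definition tensor (R : rcfType) (m l n : nat) : Type :=
  {ffun 'I_n -> 'M[R]_(m, l)}.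

(* (i - j) mod n in 'I_n, for every n.                                         *)
Definition ord_subm (n : nat) (i j : 'I_n) : 'I_n :=
  Ordinal (ltn_pmod (i + (n - j))%N (leq_ltn_trans (leq0n i) (ltn_ord i))).

Definition bcirc (R : rcfType) (m l n : nat) (A : tensor R m l n) :
    'M[R]_(\sum_(i < n) m, \sum_(j < n) l) :=
  \mxblock_(i < n, j < n) A (ord_subm i j).

Definition unfold (R : rcfType) (m l n : nat) (A : tensor R m l n) :
    'M[R]_(\sum_(i < n) m, l) :=
  \mxcol_(i < n) A i.

Definition fold (R : rcfType) (m l n : nat) (M : 'M[R]_(\sum_(i < n) m, l)) :
    tensor R m l n :=
  [ffun i => submxcol M i].

Definition tprod (R : rcfType) (m l p n : nat)
    (A : tensor R m l n) (Y : tensor R l p n) : tensor R m p n :=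
  fold (bcirc A *m unfold Y).

Definition penrose (R : rcfType) (m n : nat) (A : 'M[R]_(m, n))
    (G : 'M[R]_(n, m)) : bool :=
  [&& A *m G *m A == A, G *m A *m G == G,
      (A *m G)^T == A *m G & (G *m A)^T == G *m A].

Lemma gram_unit (R : rcfType) (m r : nat) (C : 'M[R]_(m, r)) :
  \rank C = r -> C^T *m C \in unitmx.
Proof.
move=> rC; rewrite -row_free_unit -kermx_eq0; apply/eqP/row_matrixP => i.
rewrite row0; set v := row i _.
have v0 : v *m (C^T *m C) = 0.
  by apply/eqP; rewrite -sub_kermx; exact: row_sub.
have w0 : v *m C^T = 0.
  apply/rowP => k; rewrite [RHS]mxE; apply/eqP; rewrite -sqrf_eq0; apply/eqP.
  have : (v *m C^T) *m (v *m C^T)^T = 0.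
    by rewrite trmx_mul trmxK -mulmxA (mulmxA C^T) mulmxA v0 mul0mx.
  move: (v *m C^T) => w /(congr1 (fun M : 'M_1 => M 0 0)); rewrite !mxE.
  under eq_bigr => j _ do rewrite mxE -expr2.
  by move/psumr_eq0P => -> // j _; exact: sqr_ge0.
have : row_free C^T by rewrite /row_free mxrank_tr rC.
by move/row_free_inj => inj; apply: (inj 1%N); rewrite w0 mul0mx.
Qed.

Lemma penrose_unique (R : rcfType) (m n : nat) (A : 'M[R]_(m, n))
    (G H : 'M[R]_(n, m)) :
  penrose A G -> penrose A H -> G = H.
Proof.
move=> /and4P[/eqP g1 /eqP g2 /eqP g3 /eqP g4].
move=> /and4P[/eqP h1 /eqP h2 /eqP h3 /eqP h4].
have e1 : A *m G = A *m H.
  rewrite -g3 -{1}h1 -(mulmxA (A *m H)) trmx_mul g3 h3.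
  by rewrite mulmxA g1.
have e2 : G *m A = H *m A.
  rewrite -g4 -{1}h1 -(mulmxA A) mulmxA trmx_mul g4 h4.
  by rewrite -mulmxA (mulmxA A) g1.
by rewrite -g2 -h2 e2 -!mulmxA e1.
Qed.

Lemma penrose_exists (R : rcfType) (m n : nat) (A : 'M[R]_(m, n)) :
  exists G, penrose A G.
Proof.
have [r [C [B [AE rC rB]]]] : exists r (C : 'M[R]_(m, r)) (B : 'M[R]_(r, n)),
    [/\ A = C *m B, \rank C = r & \rank B = r].
  exists (\rank A), (col_base A), (row_base A); split.
  - by rewrite mulmx_base.
  - by apply/eqP; exact: col_base_full.
  - by apply/eqP; exact: row_base_free.
have uC : C^T *m C \in unitmx by exact: gram_unit.
have uB : B *m B^T \in unitmx.
  by rewrite -{1}(trmxK B); apply: gram_unit; rewrite mxrank_tr.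
pose L := invmx (C^T *m C) *m C^T; pose K := B^T *m invmx (B *m B^T).
have LC : L *m C = 1%:M by rewrite /L -mulmxA mulVmx.
have BK : B *m K = 1%:M by rewrite /K mulmxA mulmxV.
have AG : A *m (K *m L) = C *m L.
  by rewrite AE -mulmxA (mulmxA B) BK mul1mx.
have GA : (K *m L) *m A = K *m B.
  by rewrite AE -mulmxA (mulmxA L) LC mul1mx.
exists (K *m L); rewrite /penrose AG GA; apply/and4P; split; apply/eqP.
- by rewrite AE -mulmxA (mulmxA L) LC mul1mx.
- by rewrite -mulmxA (mulmxA B) BK mul1mx.
- by rewrite /L !trmx_mul trmxK trmx_inv trmx_mul trmxK mulmxA.
- by rewrite /K !trmx_mul trmxK trmx_inv trmx_mul trmxK mulmxA.
Qed.

(* The Moore-Penrose inverse.                                                  *)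
Definition mpinv (R : rcfType) (m n : nat) (A : 'M[R]_(m, n)) : 'M[R]_(n, m) :=
  xchoose (penrose_exists A).

Lemma mpinvP (R : rcfType) (m n : nat) (A : 'M[R]_(m, n)) :
  penrose A (mpinv A).
Proof. exact: xchooseP. Qed.

Lemma ord_submE (n : nat) (i j : 'I_n.+1) : ord_subm i j = i - j.
Proof. by apply: val_inj; rewrite /= modnDmr. Qed.

Lemma penrose_shift (R : rcfType) (m l n : nat) (c : 'I_n.+1)
    (Z : 'M[R]_(\sum_(i < n.+1) m, \sum_(j < n.+1) l)) (G : 'M[R]__) :
  penrose Z G ->
  penrose (\mxblock_(i, j) submxblock Z (i + c) (j + c))
          (\mxblock_(i, j) submxblock G (i + c) (j + c)).
Proof.
have mulS a b d (X : 'M[R]_(\sum_(i < n.+1) a, \sum_(j < n.+1) b))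
    (Y : 'M[R]_(\sum_(i < n.+1) b, \sum_(j < n.+1) d)) :
    (\mxblock_(i, j) submxblock X (i + c) (j + c)) *m
      (\mxblock_(i, j) submxblock Y (i + c) (j + c)) =
    \mxblock_(i, j) submxblock (X *m Y) (i + c) (j + c).
  rewrite mul_mxblock; apply/eq_mxblockP => i j.
  have -> : X *m Y = \mxblock_(i, j)
      \sum_k submxblock X i k *m submxblock Y k j.
    by rewrite -mul_mxblock !submxblockK.
  by rewrite mxblockK [RHS](reindex_inj (addIr c)).
move=> /and4P[/eqP g1 /eqP g2 /eqP g3 /eqP g4].
apply/and4P; split; rewrite !mulS ?g1 ?g2 //.
- rewrite tr_mxblock -{2}g3; apply/eqP/eq_mxblockP => i j.
  by rewrite tr_submxblock.
- rewrite tr_mxblock -{2}g4; apply/eqP/eq_mxblockP => i j.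
  by rewrite tr_submxblock.
Qed.

Lemma bcirc_mpinv (R : rcfType) (m l n : nat) (A : tensor R m l n) :
  exists T : tensor R l m n, bcirc T == mpinv (bcirc A).
Proof.
case: n A => [|n] A.
  by exists 0; apply/eqP/mxblockP => -[].
set Z := bcirc A; set G := mpinv Z.
have shiftG c : \mxblock_(i, j) submxblock G (i + c) (j + c) = G.
  apply: penrose_unique (mpinvP Z).
  have := penrose_shift c (mpinvP Z).
  suff -> : \mxblock_(i, j) submxblock Z (i + c) (j + c) = Z by [].
  apply/mxblockP => i j; rewrite !mxblockK !ord_submE.
  by congr (A _); rewrite opprD addrACA subrr addr0.
exists [ffun k => submxblock G k 0]; apply/eqP/mxblockP => i j.
rewrite mxblockK ffunE ord_submE -[in RHS](shiftG (- j)) mxblockK.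
by rewrite subrr.
Qed.

Definition tpinv (R : rcfType) (m l n : nat) (A : tensor R m l n) :
    tensor R l m n :=
  xchoose (bcirc_mpinv A).

Lemma bcirc_tpinv (R : rcfType) (m l n : nat) (A : tensor R m l n) :
  bcirc (tpinv A) = mpinv (bcirc A).
Proof. by apply/eqP; exact: (xchooseP (bcirc_mpinv A)). Qed.

Definition tdot (R : rcfType) (m l n : nat) (A B : tensor R m l n) : R :=
  \sum_(k < n) \sum_(i < m) \sum_(j < l) A k i j * B k i j.

Definition tnorm (R : rcfType) (m l n : nat) (A : tensor R m l n) : R :=
  Num.sqrt (tdot A A).

Definition frob (R : rcfType) (m n : nat) (A : 'M[R]_(m, n)) : R :=
  Num.sqrt (\sum_(i < m) \sum_(j < n) A i j ^+ 2).

(* mxvec lists the entries of a matrix row by row, whence the inner transpose. *)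
Definition vec (R : rcfType) (m l n : nat) (A : tensor R m l n) :
    'cV[R]_(\sum_(i < n) (l * m)) :=
  \mxcol_(i < n) (mxvec (A i)^T)^T.

Definition hslice (R : rcfType) (m l n : nat) (A : tensor R m l n) (i : 'I_m) :
    tensor R 1 l n :=
  [ffun k => row i (A k)].

Section Algorithms.

Context (R : rcfType) (m l p n : nat).
Context (A : tensor R m l n) (B : tensor R m p n).
Implicit Types (X : tensor R l p n) (s : 'S_m) (i : 'I_m).

(* A_i^+ * (A_i * X - B_i) *)
Definition correction i X : tensor R l p n :=
  tprod (tpinv (hslice A i)) (tprod (hslice A i) X - hslice B i).

Definition proj i X : tensor R l p n := X - correction i X.

(* The composition of the first t projections in the order given by s, the     *)
(* projection for s 0 being applied first.                                     *)
Definition partial_sweep s (t : nat) X : tensor R l p n :=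
  foldl (fun Y i => proj i Y) X (take t [seq s i | i <- enum 'I_m]).

Definition sweep s X : tensor R l p n := partial_sweep s m X.

Definition rstack s X : 'M[R]_(\sum_(i < m) \sum_(k < n) l, p) :=
  \mxcol_(i < m) unfold (correction (s i) (partial_sweep s i X)).

Context (tau : nat) (pi : nat -> 'S_m) (X0 : tensor R l p n).

(* max (k - tau + 1) 0, with truncated subtraction *)
Definition jidx (k : nat) : nat := (k.+1 - tau)%N.

(* In an execution (x, N), x k is the k-th iterate, N = Some K means that the  *)
(* algorithm stops at iteration K (so that its last iterate is x K) and        *)
(* N = None that it never stops.  The values x k with k > K are irrelevant.    *)
Definition generated (N : option nat) (k : nat) : bool :=
  if N is Some K then (k <= K)%N else true.

Definition direction (x : nat -> tensor R l p n) (k : nat) : tensor R l p n :=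
  sweep (pi k) (x k) - x k.

Definition gamma (x : nat -> tensor R l p n) (k : nat) : R :=
  2^-1 * (frob (rstack (pi k) (x k)) ^+ 2 + tnorm (direction x k) ^+ 2).

Definition tkgk_mx (x : nat -> tensor R l p n) (k : nat) :
    'M[R]_(\sum_(i < n) (p * l), (k - jidx k).+1) :=
  \matrix_(a, c) (if (c < k - jidx k)%N
                  then vec (x (jidx k + c)%N) - vec (x k)
                  else vec (direction x k)) a 0.

Definition tkgk (x : nat -> tensor R l p n) (N : option nat) : Prop :=
  x 0%N = X0 /\
  forall k, generated N k ->
    if tnorm (direction x k) ^+ 2 == 0 then N = Some k else
    N <> Some k /\
    exists s : 'cV[R]_(k - jidx k).+1,
      (tkgk_mx x k)^T *m tkgk_mx x k *m s
        = gamma x k *: delta_mx ord_max 0 /\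
      x k.+1 = x k
        + \sum_(c < k - jidx k)
            s (widen_ord (leqnSn _) c) 0 *: (x (jidx k + c)%N - x k)
        + s ord_max 0 *: direction x k.

(* For k = 0 the sum defining u k is empty.                                    *)
Definition gs_tkgk (x : nat -> tensor R l p n) (N : option nat) : Prop :=
  exists u : nat -> tensor R l p n,
  x 0%N = X0 /\
  forall k, generated N k ->
    if direction x k == 0 then N = Some k else
    [/\ N <> Some k,
        u k = direction x k
          - \sum_(jidx k <= i < k)
              (tdot (u i) (direction x k) / tnorm (u i) ^+ 2) *: u i
      & x k.+1 = x k + (gamma x k / tnorm (u k) ^+ 2) *: u k].

End Algorithms.

(* Main.v *)
From HB Require Import structures.
Require Import Defs.
From mathcomp Require Import all_boot all_order all_algebra.
From mathcomp Require Import perm.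
From mathcomp Require Import boolp reals.
From mathcomp Require Import ring zify.

Set Implicit Arguments.
Unset Strict Implicit.
Unset Printing Implicit Defensive.

Import Order.TTheory GRing.Theory Num.Theory.
Local Open Scope ring_scope.

(* If Z solves the system, each projection P_i is a nonexpansive orthogonal
   step: |P_i X - Z|^2 = |X - Z|^2 - |P_i X - X|^2.  Summed over a sweep this
   gives gamma_k = <Z - x_k, d_k>, so gamma_k > 0 as long as d_k <> 0.  By
   induction Z - x_k is orthogonal to the Gram-Schmidt directions u_i of the
   window, and these are pairwise orthogonal; as <Z - x_k, d_k> <> 0, d_k is
   not in their span and u_k <> 0.  The window differences x_i - x_k span the
   same space as the window u_i, so lambda_k u_k lies in the column space of
   M_k and solves the normal equations M_k^T w = gamma_k e.  A vector of the
   column space is determined by these equations, hence every Gram-Schmidt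
   run is the unique TKGK run. *)

(** * Euclidean structure of tensors and the t-product *)

Section Tensors.
Context (R : rcfType).
Implicit Types (m l p n : nat).

(** The trace form lets matrix identities for the Moore-Penrose projector act on inner products. *)
Lemma tdotE m l n (X Y : tensor R m l n) :
  tdot X Y = \tr ((unfold X)^T *m unfold Y).
Proof.
rewrite /unfold tr_mxcol mul_mxrow_mxcol raddf_sum; apply: eq_bigr => k _.
rewrite exchange_big; apply: eq_bigr => j _ /=.
by rewrite mxE; apply: eq_bigr => i _; rewrite mxE.
Qed.

Lemma unfoldB m l n (X Y : tensor R m l n) :
  unfold (X - Y) = unfold X - unfold Y.
Proof. by rewrite -mxcolB; apply: eq_mxcol => i; rewrite !ffunE. Qed.

Lemma unfoldK m l n (M : 'M[R]_(\sum_(i < n) m, l)) : unfold (fold M) = M.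
Proof. by apply/mxcolP => i; rewrite mxcolK ffunE. Qed.

Lemma tdotC m l n (X Y : tensor R m l n) : tdot X Y = tdot Y X.
Proof. by rewrite !tdotE -mxtrace_tr trmx_mul trmxK. Qed.

Lemma tdot_is_linear m l n (X : tensor R m l n) :
  linear_for *%R (tdot X : tensor R m l n -> R).
Proof.
move=> a Y Z; rewrite /tdot mulr_sumr -big_split; apply: eq_bigr => k _ /=.
rewrite mulr_sumr -big_split; apply: eq_bigr => i _ /=.
rewrite mulr_sumr -big_split; apply: eq_bigr => j _ /=.
by rewrite !ffunE !mxE mulrDr mulrCA.
Qed.

HB.instance Definition _ m l n (X : tensor R m l n) :=
  GRing.isLinear.Build R (tensor R m l n) R _ (tdot X) (tdot_is_linear X).

Lemma tdotBr m l n (X Y Z : tensor R m l n) :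
  tdot X (Y - Z) = tdot X Y - tdot X Z.
Proof. exact: linearB. Qed.

Lemma tdotBl m l n (X Y Z : tensor R m l n) :
  tdot (X - Y) Z = tdot X Z - tdot Y Z.
Proof. by rewrite tdotC tdotBr !(tdotC Z). Qed.

Lemma tdotNr m l n (X Y : tensor R m l n) : tdot X (- Y) = - tdot X Y.
Proof. exact: linearN. Qed.

Lemma tdotZr m l n a (X Y : tensor R m l n) : tdot X (a *: Y) = a * tdot X Y.
Proof. exact: linearZ. Qed.

Lemma tdot_sumr m l n I (r : seq I) (P : pred I) (X : tensor R m l n)
    (F : I -> tensor R m l n) :
  tdot X (\sum_(i <- r | P i) F i) = \sum_(i <- r | P i) tdot X (F i).
Proof. exact: linear_sum. Qed.

Lemma tdot_ge0 m l n (X : tensor R m l n) : 0 <= tdot X X.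
Proof.
by apply: sumr_ge0 => k _; apply: sumr_ge0 => i _; apply: sumr_ge0 => j _;
   rewrite -expr2 sqr_ge0.
Qed.

Lemma tdot_eq0 m l n (X : tensor R m l n) : (tdot X X == 0) = (X == 0).
Proof.
apply/eqP/eqP => [X0|->]; last exact: linear0.
apply/ffunP => k; apply/matrixP => i j; rewrite !ffunE mxE.
have X_ge0 k' i' j' : 0 <= X k' i' j' * X k' i' j' by rewrite -expr2 sqr_ge0.
have X2_ge0 k' i' : 0 <= \sum_(j' < l) X k' i' j' * X k' i' j'.
  exact: sumr_ge0.
have X3_ge0 k' : 0 <= \sum_(i' < m) \sum_(j' < l) X k' i' j' * X k' i' j'.
  exact: sumr_ge0.
move/(psumr_eq0P (fun k _ => X3_ge0 k))/(_ k isT): X0.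
move/(psumr_eq0P (fun i _ => X2_ge0 k i))/(_ i isT).
move/(psumr_eq0P (fun j _ => X_ge0 k i j))/(_ j isT)/eqP.
by rewrite mulf_eq0 orbb => /eqP.
Qed.

Lemma sqr_tnorm m l n (X : tensor R m l n) : tnorm X ^+ 2 = tdot X X.
Proof. by rewrite sqr_sqrtr // tdot_ge0. Qed.

Lemma sqr_frob m n (M : 'M[R]_(m, n)) : frob M ^+ 2 = \tr (M^T *m M).
Proof.
rewrite sqr_sqrtr; last first.
  by apply: sumr_ge0 => i _; apply: sumr_ge0 => j _; exact: sqr_ge0.
rewrite exchange_big; apply: eq_bigr => j _ /=.
by rewrite mxE; apply: eq_bigr => i _; rewrite mxE expr2.
Qed.

Lemma vec_is_linear m l n : linear (@vec R m l n).
Proof.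
move=> a X Y; rewrite /vec; apply/matrixP => i j.
by rewrite !mxE !ffunE !linearP /= !mxE.
Qed.

HB.instance Definition _ m l n :=
  GRing.isLinear.Build R (tensor R m l n) _ _ (@vec R m l n)
    (@vec_is_linear m l n).

Lemma vecB m l n (X Y : tensor R m l n) : vec (X - Y) = vec X - vec Y.
Proof. exact: linearB. Qed.

(** This bridge turns the normal equations, which concern matrices, into inner products of
    tensors. *)
Lemma tdot_vec m l n (X Y : tensor R m l n) :
  (vec X)^T *m vec Y = (tdot X Y)%:M.
Proof.
rewrite [LHS]mx11_scalar; congr (_%:M).
rewrite tr_mxcol mul_mxrow_mxcol summxE; apply: eq_bigr => k _.
rewrite trmxK mxE (reindex _ (curry_mxvec_bij _ _)) /= exchange_big pair_bigA.
by apply: eq_bigr => -[i j] _ /=; rewrite mxE !mxvecE !mxE.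
Qed.

Lemma vec_inj m l n : injective (@vec R m l n).
Proof.
move=> X Y eXY; apply/eqP; rewrite -subr_eq0 -tdot_eq0; apply/eqP.
have := tdot_vec (X - Y) (X - Y); rewrite vecB eXY subrr mulmx0.
by move/(congr1 (fun M : 'M_1 => M 0 0)); rewrite !mxE.
Qed.

(* H G is a symmetric idempotent when H is the Moore-Penrose inverse of G. *)
Lemma tdot_tpinv m l p n (A : tensor R m l n) (X : tensor R l p n) :
  let C := tprod (tpinv A) (tprod A X) in tdot C X = tdot C C.
Proof.
set C := tprod _ _ => /=.
have CE : unfold C = mpinv (bcirc A) *m bcirc A *m unfold X.
  by rewrite !unfoldK bcirc_tpinv mulmxA.
have /and4P[_ /eqP HGH _ /eqP sym] := mpinvP (bcirc A).
rewrite !tdotE CE [in LHS]trmx_mul [in RHS]trmx_mul sym -!mulmxA.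
by congr (\tr (_ *m _)); rewrite !mulmxA HGH.
Qed.

Lemma tprodB m l p n (A : tensor R m l n) (X Y : tensor R l p n) :
  tprod A (X - Y) = tprod A X - tprod A Y.
Proof.
rewrite /tprod unfoldB mulmxBr.
by apply/ffunP => i; rewrite !ffunE submxcolB.
Qed.

(** Hence a solution of the full system solves the equation of every horizontal slice. *)
Lemma hslice_tprod m l p n (A : tensor R m l n) (X : tensor R l p n) i :
  hslice (tprod A X) i = tprod (hslice A i) X.
Proof.
apply/ffunP => k; rewrite !ffunE /bcirc /unfold !mul_mxblock_mxrow !mxcolK.
rewrite linear_sum; apply: eq_bigr => j _ /=.
by rewrite ffunE row_mul.
Qed.

End Tensors.

(** * Projection sweeps and the value of [gamma] *)

Section Sweeps.
Context (R : rcfType) (m l p n : nat).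
Context (A : tensor R m l n) (B : tensor R m p n).
Context (Z : tensor R l p n) (AZ : tprod A Z = B).
Implicit Types (X : tensor R l p n) (s : 'S_m).

(** Pythagoras: as [Z] solves slice [i], the correction is the orthogonal projection of [X - Z], and
    [proj] leaves the complementary part. *)
Lemma tdot_proj i X :
  tdot (proj A B i X - Z) (proj A B i X - Z) =
  tdot (X - Z) (X - Z) - tdot (correction A B i X) (correction A B i X).
Proof.
have CZ : tdot (correction A B i X) (X - Z) =
          tdot (correction A B i X) (correction A B i X).
  by rewrite /correction -AZ hslice_tprod -tprodB tdot_tpinv.
have -> : proj A B i X - Z = X - Z - correction A B i X by rewrite /proj addrAC.
move: (correction A B i X) (X - Z) CZ => C D CD.
by rewrite tdotBl !tdotBr (tdotC D) CD subrr subr0.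
Qed.

Lemma partial_sweepS s X t (tm : (t < m)%N) :
  partial_sweep A B s t.+1 X = proj A B (s (Ordinal tm)) (partial_sweep A B s t X).
Proof.
have takeS : take t.+1 [seq s i | i <- enum 'I_m] =
    rcons (take t [seq s i | i <- enum 'I_m]) (s (Ordinal tm)).
  rewrite (take_nth (s (Ordinal tm))); last by rewrite size_map size_enum_ord.
  rewrite (nth_map (Ordinal tm)); last by rewrite size_enum_ord.
  by rewrite (nth_ord_enum _ (Ordinal tm)).
by rewrite /partial_sweep takeS foldl_rcons.
Qed.

(** Telescopes [tdot_proj]. The guard [i < t] keeps all indices in ['I_m] while [t] grows. *)
Lemma tdot_partial_sweep s X t : (t <= m)%N ->
  let C i := correction A B (s i) (partial_sweep A B s i X) in
  let Y := partial_sweep A B s t X in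
  tdot (Y - Z) (Y - Z) =
  tdot (X - Z) (X - Z) - \sum_(i < m | (i < t)%N) tdot (C i) (C i).
Proof.
move=> tm C /=; elim: t tm => [|t IHt] tm.
  by rewrite big_pred0_eq subr0 /partial_sweep take0.
rewrite partial_sweepS tdot_proj (IHt (ltnW tm)) [in RHS](bigD1 (Ordinal tm)) //=.
rewrite opprD addrA [RHS]addrAC; congr +%R; congr (_ - _).
apply: eq_bigl => i; rewrite ltnS -val_eqE /=; lia.
Qed.

Lemma sqr_frob_rstack s X :
  frob (rstack A B s X) ^+ 2 =
  tdot (X - Z) (X - Z) - tdot (sweep A B s X - Z) (sweep A B s X - Z).
Proof.
rewrite (tdot_partial_sweep s X (leqnn m)) opprB addrC subrK.
rewrite sqr_frob tr_mxcol mul_mxrow_mxcol raddf_sum.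
apply: eq_big => [i|i _]; first by rewrite ltn_ord.
by rewrite /= -tdotE.
Qed.

Context (tau : nat) (pi : nat -> 'S_m).

(** With [W = Z - x k] and [d] the direction, the squared norm of the stack is |W|^2 - |d - W|^2 =
    2<W, d> - |d|^2; adding |d|^2 and halving leaves <W, d>. *)
Lemma gammaE (x : nat -> tensor R l p n) k :
  gamma A B pi x k = tdot (Z - x k) (direction A B pi x k).
Proof.
rewrite /gamma sqr_tnorm sqr_frob_rstack.
set Y := sweep _ _ _ _; have dE : direction A B pi x k = Y - x k by [].
have -> : Y - Z = direction A B pi x k - (Z - x k).
  by rewrite dE opprB addrA subrK.
have -> : x k - Z = - (Z - x k) by rewrite opprB.
move: (direction _ _ _ _ _) (Z - x k) => d W.
rewrite !tdotBl !tdotBr !tdotNr (tdotC (- W)) tdotNr (tdotC d W).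
by field.
Qed.

Lemma gamma_gt0 (x : nat -> tensor R l p n) k :
  direction A B pi x k != 0 -> 0 < gamma A B pi x k.
Proof.
move=> d0; rewrite mulr_gt0 ?invr_gt0 ?ltr0n // ltr_wpDl ?sqr_ge0 //.
by rewrite sqr_tnorm lt_def tdot_eq0 d0 tdot_ge0.
Qed.

(** * Orthogonality of the Gram-Schmidt directions *)

Lemma jidx_homo i k : (i <= k)%N -> (jidx tau i <= jidx tau k)%N.
Proof. by move=> ik; rewrite leq_sub2r. Qed.

Definition gs_step (x u : nat -> tensor R l p n) (k : nat) : Prop :=
  [/\ direction A B pi x k != 0,
      u k = direction A B pi x k
        - \sum_(jidx tau k <= i < k)
            (tdot (u i) (direction A B pi x k) / tnorm (u i) ^+ 2) *: u i
    & x k.+1 = x k + (gamma A B pi x k / tnorm (u k) ^+ 2) *: u k].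

(** [u k] differs from the direction by window terms orthogonal to the residual, so only the product
    computed in [gammaE] survives. *)
Lemma gs_residual (x u : nat -> tensor R l p n) k :
  gs_step x u k ->
  (forall i, (jidx tau k <= i < k)%N -> tdot (u i) (Z - x k) = 0) ->
  tdot (u k) (Z - x k) = gamma A B pi x k.
Proof.
move=> [_ -> _] c0; rewrite tdotBl [X in _ - X]tdotC tdot_sumr.
rewrite big_nat big1 => [|i ijk]; first by rewrite subr0 tdotC -gammaE.
by rewrite tdotZr [X in _ * X]tdotC (c0 _ ijk) mulr0.
Qed.

(* The truncation windows are nested, so that local orthogonalization makes
   all the directions of one window pairwise orthogonal. *)
Lemma gs_invariant (x u : nat -> tensor R l p n) k :
  (forall i, (i < k)%N -> gs_step x u i) ->
  (forall i, (jidx tau k <= i < k)%N -> tdot (u i) (Z - x k) = 0) /\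
  (gs_step x u k ->
     tdot (u k) (u k) != 0 /\
     forall i, (jidx tau k <= i < k)%N -> tdot (u i) (u k) = 0).
Proof.
elim/ltn_ind: k => k IH stepk.
have {}IH i : (i < k)%N ->
    [/\ forall j, (jidx tau i <= j < i)%N -> tdot (u j) (Z - x i) = 0,
        tdot (u i) (u i) != 0
      & forall j, (jidx tau i <= j < i)%N -> tdot (u j) (u i) = 0].
  move=> ik; have [j ji|c /(_ (stepk i ik))[]] // := IH i ik.
  by apply: stepk; exact: ltn_trans ik.
have c0 i : (jidx tau k <= i < k)%N -> tdot (u i) (Z - x k) = 0.
  case: k stepk IH => [|k] stepk IH; first by rewrite ltn0 andbF.
  have [_ _ xE] := stepk k (ltnSn k).
  have [c a b] := IH k (ltnSn k).
  move=> /andP[ji]; rewrite ltnS leq_eqVlt => ik.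
  have jk : (jidx tau k <= i)%N by exact: leq_trans (jidx_homo (leqnSn k)) ji.
  rewrite xE opprD addrA tdotBr tdotZr sqr_tnorm.
  (* Older directions are orthogonal to both the residual and [u k]; for the newest one the step
     length is exactly what cancels the residual along [u k]. *)
  case/orP: ik => [/eqP ->|ik]; last first.
    have ijk : (jidx tau k <= i < k)%N by rewrite jk.
    by rewrite (c _ ijk) (b _ ijk) mulr0 subr0.
  by rewrite (gs_residual (stepk k (ltnSn k)) c) divfK ?subrr.
split=> // Ek; split.
  (* A vanishing [u k] would make [gamma] zero by [gs_residual]. *)
  apply/negP; rewrite tdot_eq0 => /eqP u0.
  have [d0 _ _] := Ek; have := gamma_gt0 d0.
  by rewrite -(gs_residual Ek c0) u0 tdotC linear0 ltxx.
move=> i ijk; have [_ -> _] := Ek.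
have /andP[ji ik] := ijk.
rewrite tdotBr tdot_sumr (bigD1_seq i) ?iota_uniq ?mem_index_iota //=.
rewrite tdotZr sqr_tnorm divfK; last by have [] := IH i ik.
rewrite big_nat_cond big1 ?addr0 ?subrr // => j /andP[/andP[jj jk] ne].
(* The window of the larger of [i] and [j] contains the smaller, so the two directions are already
   orthogonal. *)
rewrite tdotZr; case: (ltngtP i j) ne => // [ij|lt_ji] _.
  have [_ _ ->] := IH j jk; first by rewrite mulr0.
  by rewrite ij andbT (leq_trans _ ji) // jidx_homo // ltnW.
have [_ _ b] := IH i ik; rewrite [X in _ * X]tdotC b ?mulr0 //.
by rewrite lt_ji andbT (leq_trans _ jj) // jidx_homo // ltnW.
Qed.

(** * Normal equations and the Gram-Schmidt increment *)

Definition tkgk_step (x : nat -> tensor R l p n) k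
    (s : 'cV[R]_(k - jidx tau k).+1) : tensor R l p n :=
  \sum_(c < k - jidx tau k)
    s (widen_ord (leqnSn _) c) 0 *: (x (jidx tau k + c)%N - x k)
  + s ord_max 0 *: direction A B pi x k.

Lemma row_tkgk_mx (x : nat -> tensor R l p n) k c :
  row c (tkgk_mx A B tau pi x k)^T =
  (vec (if (c < k - jidx tau k)%N then x (jidx tau k + c)%N - x k
        else direction A B pi x k))^T.
Proof.
apply/rowP => a; rewrite [RHS]mxE 3![LHS]mxE.
by case: ifP => // _; rewrite vecB.
Qed.

Lemma tkgk_mx_mul (x : nat -> tensor R l p n) k
    (s : 'cV[R]_(k - jidx tau k).+1) :
  tkgk_mx A B tau pi x k *m s = vec (tkgk_step x s).
Proof.
apply: trmx_inj; rewrite trmx_mul mulmx_sum_row big_ord_recr /=.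
rewrite row_tkgk_mx ltnn mxE !linearD !linear_sum !linearZ /=; congr (_ + _).
apply: eq_bigr => c _.
by rewrite row_tkgk_mx /= ltn_ord [s^T _ _]mxE linearZ /= linearZ.
Qed.

Lemma gs_step_tkgk (x u : nat -> tensor R l p n) k :
  (forall i, (i <= k)%N -> gs_step x u i) ->
  exists s : 'cV[R]_(k - jidx tau k).+1,
    (tkgk_mx A B tau pi x k)^T *m tkgk_mx A B tau pi x k *m s
      = gamma A B pi x k *: delta_mx ord_max 0 /\
    x k.+1 = x k + tkgk_step x s.
Proof.
move=> stepk; set M := tkgk_mx _ _ _ _ _ _.
have inv i : (i <= k)%N -> tdot (u i) (u i) != 0 /\
    forall j, (jidx tau i <= j < i)%N -> tdot (u j) (u i) = 0.
  move=> ik; have [|_] := @gs_invariant x u i; last by apply; exact: stepk.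
  by move=> j /ltnW ji; apply: stepk; exact: leq_trans ik.
have [uk0 orth] := inv k (leqnn k).
have [d0 uE xE] := stepk k (leqnn k).
set w := (_ / _) *: u k in xE.
(* [S X] says that [vec X] lies in the column space of [M]. The coefficients [s] will come from
   membership of [w], without a formula. *)
pose S X := ((vec X)^T <= M^T)%MS.
have SD X Y : S X -> S Y -> S (X + Y).
  by move=> *; rewrite /S linearD /= linearD /= addmx_sub.
have SZ a X : S X -> S (a *: X).
  by move=> *; rewrite /S linearZ /= linearZ /= scalemx_sub.
have S0 : S 0 by rewrite /S linear0 trmx0 sub0mx.
have Sx i : (jidx tau k <= i <= k)%N -> S (x i - x k).
  case/andP => ji; rewrite leq_eqVlt => /orP[/eqP ->|ik]; first by rewrite subrr.
  have cP : (i - jidx tau k < (k - jidx tau k).+1)%N.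
    by rewrite ltnS leq_sub2r // ltnW.
  have := row_sub (Ordinal cP) M^T.
  by rewrite row_tkgk_mx /= ltn_sub2r ?subnKC // (leq_ltn_trans ji).
have Sd : S (direction A B pi x k).
  by have := row_sub ord_max M^T; rewrite row_tkgk_mx ltnn.
have Su i : (jidx tau k <= i < k)%N -> S (u i).
  case/andP => ji ik; have [di0 _ xiE] := stepk i (ltnW ik).
  have [ui0 _] := inv i (ltnW ik).
  set a := _ / _ in xiE.
  (* The step length is nonzero because [gamma] is positive, so [u i] can be recovered from
     [x i.+1 - x i]. *)
  have a0 : a != 0 by rewrite mulf_neq0 ?invr_eq0 ?sqr_tnorm // gt_eqF ?gamma_gt0.
  have -> : u i = a^-1 *: ((x i.+1 - x k) + -1 *: (x i - x k)).
    rewrite scaleN1r opprB addrA subrK xiE addrC addKr scalerA mulVf //.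
    by rewrite scale1r.
  by apply/SZ/SD; [|apply: SZ]; apply: Sx; rewrite ?(leqW ji) ?ji ?ik // ltnW.
have Sw : S w.
  apply/SZ; rewrite uE -scaleN1r; apply/SD/SZ => //.
  rewrite big_nat; elim/big_ind: _ => // i /Su ?; exact/SZ.
have /submxP[D wE] := Sw.
have vwE : vec w = M *m D^T by rewrite -[LHS]trmxK wE trmx_mul trmxK.
exists D^T; split; last first.
  by rewrite xE; congr (_ + _); apply: vec_inj; rewrite vwE tkgk_mx_mul.
rewrite -mulmxA -vwE; apply/row_matrixP => c.
rewrite row_mul row_tkgk_mx tdot_vec; apply/rowP => z; rewrite {z}ord1 !mxE eqxx.
rewrite mulr1n andbT tdotZr sqr_tnorm -val_eqE /=; case: ifP => ck.
  rewrite (ltn_eqF ck) mulr0.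
  set i := (jidx tau k + c)%N.
  have ik : (i <= k)%N by rewrite /i; lia.
  (* For a window column, [x k - x i] telescopes into multiples of [u t] with [i <= t < k], all
     orthogonal to [u k]. *)
  rewrite -opprB -(telescope_sumr _ ik) tdotC tdotNr tdot_sumr.
  rewrite big_nat big1 ?oppr0 ?mulr0 // => t /andP[it tk].
  have [_ _ ->] := stepk t (ltnW tk).
  rewrite addrAC subrr add0r tdotZr [X in _ * X]tdotC orth ?mulr0 // tk andbT.
  by apply: leq_trans it; exact: leq_addr.
(* Last column: Gram-Schmidt removed only parts orthogonal to [u k], so <d, u k> = |u k|^2 cancels
   the denominator in [w]. *)
have -> : (c : nat) == (k - jidx tau k)%N by move: (ltn_ord c); lia.
suff -> : tdot (direction A B pi x k) (u k) = tdot (u k) (u k).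
  by rewrite divfK // mulr1.
have dE : direction A B pi x k = u k
    + \sum_(jidx tau k <= i < k)
        (tdot (u i) (direction A B pi x k) / tnorm (u i) ^+ 2) *: u i.
  by rewrite [in RHS]uE subrK.
rewrite tdotC dE linearD /= tdot_sumr big_nat big1 ?addr0 // => i ijk.
by rewrite tdotZr [X in _ * X]tdotC orth // mulr0.
Qed.

End Sweeps.

(** * Stopping indices, uniqueness and existence of runs *)

Lemma generated_leq (N : option nat) i k :
  (i <= k)%N -> generated N k -> generated N i.
Proof. by case: N => // K ik /(leq_trans ik). Qed.

Lemma generated_not_last (N : option nat) i k :
  (i < k)%N -> generated N k -> N <> Some i.
Proof. by case: N => // K ik /(leq_trans ik) /= iK [E]; rewrite E ltnn in iK. Qed.

Lemma generatedS (N : option nat) k :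
  generated N k -> N <> Some k -> generated N k.+1.
Proof. by case: N => //= K; rewrite leq_eqVlt => /orP[/eqP ->|]. Qed.

Section Runs.
Context (R : rcfType) (m l p n : nat).
Context (A : tensor R m l n) (B : tensor R m p n).
Context (tau : nat) (pi : nat -> 'S_m) (X0 : tensor R l p n).
Implicit Types (x y u : nat -> tensor R l p n) (N : option nat).

Lemma gs_run_tkgk (Z : tensor R l p n) x N : tprod A Z = B ->
  gs_tkgk A B tau pi X0 x N -> tkgk A B tau pi X0 x N.
Proof.
move=> AZ [u [x0 run]]; split=> // k gk; rewrite sqr_tnorm tdot_eq0.
have := run k gk; case: ifP => // dk [Nk _ _]; split=> //.
(* No direction up to [k] vanishes: at [k] by the current case, and earlier because the run would
   have stopped before [k]. *)
have stepk i : (i <= k)%N -> gs_step A B tau pi x u i.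
  move=> ik; have := run i (generated_leq ik gk).
  case: ifP => [di Ni|/negbT di [_ uE xE]]; last by split.
  move: ik; rewrite leq_eqVlt => /orP[/eqP E|ik]; first by rewrite -E di in dk.
  by have := generated_not_last ik gk.
have [s [sE xE]] := gs_step_tkgk AZ stepk.
by exists s; split=> //; rewrite xE /tkgk_step addrA.
Qed.

(* M s only depends on M^T M s, although s itself need not. *)
Lemma tkgk_step_inj x k (s t : 'cV[R]_(k - jidx tau k).+1) :
  let M := tkgk_mx A B tau pi x k in
  M^T *m M *m s = M^T *m M *m t ->
  tkgk_step A B pi x s = tkgk_step A B pi x t.
Proof.
move=> M Mst; apply/eqP; rewrite -subr_eq0 -tdot_eq0; apply/eqP.
set W := _ - _; have WE : vec W = M *m (s - t).
  by rewrite vecB -!tkgk_mx_mul mulmxBr.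
have := tdot_vec W W.
rewrite WE trmx_mul -mulmxA [M^T *m _]mulmxA mulmxBr Mst subrr mulmx0.
by move/(congr1 (fun M : 'M_1 => M 0 0)); rewrite !mxE.
Qed.

(** Equal iterates up to [k] give the same stopping test and the same normal equations; the
    solutions [s] and [t] may differ, but their increments agree by [tkgk_step_inj]. *)
Lemma tkgk_agree x N y N' k :
  tkgk A B tau pi X0 x N -> tkgk A B tau pi X0 y N' -> generated N k ->
  generated N' k /\ forall i, (i <= k)%N -> x i = y i.
Proof.
move=> [x0 runx] [y0 runy]; elim: k => [_|k IHk gk1].
  by split=> [|i]; [case: N' {runy}|rewrite leqn0 => /eqP ->; rewrite x0 y0].
have gk := generated_leq (leqnSn k) gk1; have [gk' xy] := IHk gk.
have Nk := generated_not_last (ltnSn k) gk1.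
have dxy : direction A B pi x k = direction A B pi y k.
  by rewrite /direction xy.
have := runx k gk; case: ifP => // dx [_ [s [sE xE]]].
have := runy k gk'; rewrite -dxy dx => -[N'k [t [tE yE]]].
split=> [|i]; first exact: generatedS.
rewrite leq_eqVlt ltnS => /orP[/eqP ->|]; last exact: xy.
have Mxy : tkgk_mx A B tau pi x k = tkgk_mx A B tau pi y k.
  apply/matrixP => a c; rewrite [LHS]mxE [RHS]mxE dxy (xy k) //.
  by case: ifP => // ck; rewrite xy //; lia.
have gxy : gamma A B pi x k = gamma A B pi y k by rewrite /gamma dxy xy.
have st : tkgk_step A B pi x s = tkgk_step A B pi x t.
  by apply: tkgk_step_inj; rewrite /= sE Mxy tE gxy.
rewrite xE -addrA [X in _ + X]st yE -addrA xy // /tkgk_step dxy.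
congr (_ + (_ + _)); apply: eq_bigr => c _; rewrite !xy //.
by have := ltn_ord c; lia.
Qed.

Lemma tkgk_unique x N y N' :
  tkgk A B tau pi X0 x N -> tkgk A B tau pi X0 y N' ->
  N = N' /\ forall k, generated N k -> x k = y k.
Proof.
move=> runx runy; split; last first.
  by move=> k /(tkgk_agree runx runy)[_]; apply.
have agree := tkgk_agree runx runy; have agree' := tkgk_agree runy runx.
(* Compare at the stopping indices, or just past one of them when the other run is infinite. *)
case: N N' agree agree' {runx runy} => [K|] [K'|] //= agree agree'.
- congr Some; apply/eqP; rewrite eqn_leq.
  by rewrite (agree K _).1 // (agree' K' _).1.
- by have [] := agree' K.+1 isT; rewrite ltnn.
- by have [] := agree K'.+1 isT; rewrite ltnn.
Qed.

(* The Gram-Schmidt iteration continued past the stopping index; a state at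
   time k holds x k and the directions u i for i < k. *)
Definition gs_next (k : nat) (st : tensor R l p n * (nat -> tensor R l p n)) :=
  let: (X, u) := st in
  let D := direction A B pi (fun=> X) k in
  let U := D - \sum_(jidx tau k <= i < k)
                 (tdot (u i) D / tnorm (u i) ^+ 2) *: u i in
  (X + (gamma A B pi (fun=> X) k / tnorm U ^+ 2) *: U,
   fun i => if i == k then U else u i).

(** The initial zero directions are placeholders: step [k] reads only directions below [k], already
    written by then. *)
Definition gs_state (k : nat) : tensor R l p n * (nat -> tensor R l p n) :=
  iteri k gs_next (X0, fun=> 0).

Lemma gs_run_exists : exists x N, gs_tkgk A B tau pi X0 x N.
Proof.
(* State [k.+1] is the first to contain direction [k]. *)
pose x k := (gs_state k).1; pose u k := (gs_state k.+1).2 k.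
have uE i k : (i < k)%N -> (gs_state k).2 i = u i.
  elim: k => // k IHk; rewrite ltnS leq_eqVlt => /orP[/eqP -> //|ik].
  rewrite /= /gs_next; case E: (gs_state k) => [X v] /=.
  by rewrite (ltn_eqF ik) -(IHk ik) E.
have stepE k : u k = direction A B pi x k
      - \sum_(jidx tau k <= i < k)
          (tdot (u i) (direction A B pi x k) / tnorm (u i) ^+ 2) *: u i /\
    x k.+1 = x k + (gamma A B pi x k / tnorm (u k) ^+ 2) *: u k.
  have ukE : u k = direction A B pi x k
      - \sum_(jidx tau k <= i < k)
          (tdot (u i) (direction A B pi x k) / tnorm (u i) ^+ 2) *: u i.
    rewrite [LHS]/u /= /gs_next /direction [in RHS]/x.
    case E: (gs_state k) => [X v] /=; rewrite eqxx; congr (_ - _).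
    rewrite big_nat [RHS]big_nat; apply: eq_bigr => i /andP[_ ik].
    by rewrite -(uE _ _ ik) E.
  split=> //; rewrite [LHS]/x /= /gs_next [u k]/u /= /gs_next.
  by rewrite /gamma /direction [in RHS]/x; case: (gs_state k) => X v /=; rewrite eqxx.
(* Classically, cut the iteration at its first vanishing direction, or never if there is none. *)
have [ex|nex] := pselect (exists k, direction A B pi x k == 0).
  case: (ex_minnP ex) => K dK minK.
  exists x, (Some K), u; split=> // k /= kK; case: ifP => [dk|dk].
    by congr Some; apply/eqP; rewrite eqn_leq kK minK.
  by have [uk xk] := stepE k; split=> // -[KE]; rewrite -KE dK in dk.
exists x, None, u; split=> // k _; case: ifP => [dk|_].
  by case: nex; exists k.
by have [] := stepE k.
Qed.

End Runs.

Theorem theorem4p2 (R : realType) (m l p n : nat)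
    (A : tensor R m l n) (B : tensor R m p n)
    (tau : nat) (htau : (1 <= tau)%N)
    (pi : nat -> 'S_m) (X0 : tensor R l p n)
    (consistent : exists X : tensor R l p n, tprod A X = B) :
  (exists x N, tkgk A B tau pi X0 x N) /\
  (exists y N, gs_tkgk A B tau pi X0 y N) /\
  (forall x N y N',
     tkgk A B tau pi X0 x N -> gs_tkgk A B tau pi X0 y N' ->
     N = N' /\ forall k, generated N k -> x k = y k).
Proof.
(* One Gram-Schmidt run witnesses both existence claims, since it is also a TKGK run. *)
have [Z AZ] := consistent; have [y [N run]] := gs_run_exists A B tau pi X0.
split; [|split]; first by exists y, N; exact: gs_run_tkgk AZ run.
  by exists y, N.
by move=> x N1 y1 N2 runx /(gs_run_tkgk AZ); exact: tkgk_unique.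
Qed.
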